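(* Let $b\in[H^\infty_d\otimes\mathscr L(\mathcal H)]_1$ be purely contractive and let $A\in\mathscr L(\mathcal H)$ be unitary. Then $$\mathcal F_{bA^*}(\hat V^A)^*=\left(X^*+BA^*(I-b(0)A^* )^{-1}k_0^*\right)\mathcal F_{bA^*},$$ where $X$ is the minimal contractive Gleason solution for $K(b)$ and $B$ is the minimal contractive Gleason solution for $b$.
   Context: Let $d\ge1$ and let $\mathcal H$ be a non-zero complex Hilbert space, finite dimensional or separable; inner products are conjugate linear in the first argument; $\bigvee$ is closed linear span; $\mathbb B^d$ is the open unit ball of $\mathbb C^d$, $zw^*:=\sum_jz_j\overline{w_j}$. $[H^\infty_d\otimes\mathscr L(\mathcal H)]_1$ is the closed unit ball of the multiplier algebra of the space $H^2_d\otimes\mathcal H$ with kernel $\frac1{1-zw^*}I_{\mathcal H}$; $b$ is purely contractive if $\|b(z)\|<1$ on $\mathbb B^d$. $K(b)$ is the reproducing kernel Hilbert space of $\mathcal H$-valued functions on $\mathbb B^d$ with kernel $k^b(z,w)=\frac{I-b(z)b(w)^*}{1-zw^*}$; note $K(bA^* )=K(b)$. $k_w=k_w^b:\mathcal H\to K(b)$ is the adjoint of evaluation at $w$. For any purely contractive Schur class $c$ (applied to $c=b$ and $c=bA^*$): the Herglotz space $\mathscr L(c)$ is the reproducing kernel Hilbert space with kernel $K^c(z,w)=\frac12\frac{H_c(z)+H_c(w)^*}{1-zw^*}$, $H_c=(I-c)^{-1}(I+c)$; $K_w^c$ is the adjoint of evaluation at $w$; $V^c:\mathscr L(c)\otimes\mathbb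 C^d\to\mathscr L(c)$ is the partial isometry with initial space $\bigvee w^*K^c_wh$, where $w^*K_w^ch=(\overline{w_1}K^c_wh,\dots,\overline{w_d}K^c_wh)^T$, and $V^c(w^*K^c_wh)=(K^c_w-K^c_0)h$. $U_c:K(c)\to\mathscr L(c)$, $(U_cF)(z)=(I-c(z))^{-1}F(z)$, is unitary. Let $L=(L_1,\dots,L_d)$ be the left creation operators on the full Fock space over $\mathbb C^d$, $zL^*=\sum_jz_jL_j^*$, $Lz^*=\sum_j\overline{z_j}L_j$, and $\mathcal S$ the norm-closed span of $\{(I-Lz^* )^{-1}:z\in\mathbb B^d\}$; $\mathcal S+\mathcal S^*$ denotes norm closure. $\mu_c:\mathcal S+\mathcal S^*\to\mathscr L(\mathcal H)$ is the completely positive map with $\mu_c((I-zL^* )^{-1}(I-Lw^* )^{-1})=K^c(z,w)$. $P^2(c)$ is the Hilbert space completion of $\mathcal S\otimes\mathcal H$ modulo null vectors for $\langle p\otimes h,q\otimes g\rangle=\langle h,\mu_c(p^*q)g\rangle$. The weighted Cauchy transform $\mathcal F_c:P^2(c)\to K(c)$, $(\mathcal F_c(p\otimes h))(z)=(I-c(z))\mu_c((I-zL^* )^{-1}p)h$, is unitary, and $\mathcal C_c:=U_c\mathcal F_c:P^2(c)\to\mathscr L(c)$ is the (unitary) Cauchy transform. These maps are applied componentwise on tensor products with $\mathbb C^d$; in particular the leftmost $\mathcal F_{bA^*}$ in the claim means $\mathcal F_{bA^*}\otimes I_{\mathbb C^d}$. $\hat V^A:P^2(bA^* )\otimes\mathbb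 C^d\to P^2(bA^* )$ is the partial isometry $\hat V^A=\mathcal C_{bA^*}^*V^{bA^*}\mathcal C_{bA^*}$. (Equivalently, it is the compression to $P^2(bA^* )$ of the row isometry $\pi(L)$ acting by left multiplication on the Stinespring space $Q^2$ of the extension $\nu(L^\alpha)=(K_0^{bA^*})^*(V^{bA^*})^\alpha K_0^{bA^*}$ of $\mu_{bA^*}$ to the operator system $\overline{\mathcal A+\mathcal A^*}$, where $\mathcal A$ is the unital norm-closed algebra generated by the $L_j$.) Contractive Gleason solutions: for $b$, these are $B=(b_1,\dots,b_d)^T\in\mathscr L(\mathcal H,K(b)\otimes\mathbb C^d)$ with $b(z)h-b(0)h=\sum_jz_j(b_jh)(z)$ and $B^*B\le I-b(0)^*b(0)$; for $K(b)$, row operators $X$ on $K(b)$ with $\sum_jz_j(X_j^*f)(z)=f(z)-f(0)$ and $XX^*\le I-k_0k_0^*$. The minimal ones are $B:=U_b^*(V^b)^*K_0^b(I-b(0))$ and the $X$ determined by $X^*k_w=w^*k_w-Bb(w)^*$, $w\in\mathbb B^d$, where $w^*k_wh=(\overline{w_1}k_wh,\dots,\overline{w_d}k_wh)^T$. *)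

(* Defs.v *)
From HB Require Import structures.
From mathcomp Require Import all_boot all_order all_algebra.
From mathcomp Require Import complex ring lra.
From mathcomp Require Import all_classical all_reals.
From mathcomp Require Import topology normedtype.

Set Implicit Arguments.
Unset Strict Implicit.
Unset Printing Implicit Defensive.

Import Order.TTheory GRing.Theory Num.Theory.
Import numFieldNormedType.Exports.
Local Open Scope classical_set_scope.
Local Open Scope ring_scope.

(* The inner product is linear in its second argument and conjugate linear in
   its first. *)
HB.mixin Record isHilbert (R : realType) V
    & CompleteNormedModule (complex R) V := {
  ip : V -> V -> complex R;
  ip_linear : forall x (a : complex R) y z, ip x (a *: y + z) = a * ip x y + ip x z;
  ip_conj : forall x y, ip y x = (ip x y)^*;
  ip_norm : forall x, ip x x = `|x| ^+ 2
}.

#[short(type="hilbertType")]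
HB.structure Definition Hilbert (R : realType) :=
  {V of CompleteNormedModule (complex R) V & isHilbert R V}.

Section PreHilbert.
Variables (C : numClosedFieldType) (V : lmodType C) (f : V -> V -> C).
Hypothesis f_linear : forall x a y z, f x (a *: y + z) = a * f x y + f x z.
Hypothesis f_conj : forall x y, f y x = (f x y)^*.
Hypothesis f_ge0 : forall x, 0 <= f x x.
Hypothesis f_def : forall x, f x x = 0 -> x = 0.

Lemma form0r x : f x 0 = 0.
Proof. by have := f_linear x (-1) 0 0; rewrite scaler0 addr0 mulN1r addNr. Qed.

Lemma formDr x y z : f x (y + z) = f x y + f x z.
Proof. by rewrite -[y]scale1r f_linear mul1r scale1r. Qed.

Lemma formZr x a y : f x (a *: y) = a * f x y.
Proof. by rewrite -[a *: y]addr0 f_linear form0r addr0. Qed.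

Lemma formDl x y z : f (x + y) z = f x z + f y z.
Proof. by rewrite f_conj formDr rmorphD/= -!f_conj. Qed.

Lemma formZl a x y : f (a *: x) y = a^* * f x y.
Proof. by rewrite f_conj formZr rmorphM/= -f_conj. Qed.

Definition form_norm x := sqrtC (f x x).

Lemma form_norm_ge0 x : 0 <= form_norm x.
Proof. by rewrite sqrtC_ge0. Qed.

Lemma form_norm_sqr x : form_norm x ^+ 2 = f x x.
Proof. by rewrite sqrtCK. Qed.

Lemma form_cauchy_schwarz x y : `|f x y| <= form_norm x * form_norm y.
Proof.
have [->|y0] := eqVneq y 0.
  by rewrite form0r normr0 mulr_ge0// form_norm_ge0.
have fy0 : 0 < f y y.
  by rewrite lt_def f_ge0 andbT; apply: contraNneq y0 => /f_def ->.
rewrite -(@ler_pXn2r _ 2)// ?nnegrE ?mulr_ge0 ?form_norm_ge0//.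
rewrite exprMn !form_norm_sqr normCK.
set N := f y y in fy0 *; set P := f x y.
have N0 : N != 0 by rewrite gt_eqF.
have Q : f y x = P^* by rewrite f_conj.
have Nc : N^* = N by rewrite geC0_conj ?ltW.
have := f_ge0 (- (P^* / N) *: y + x).
rewrite f_linear formDl formZl formDl formZl -/N -/P Q.
rewrite rmorphN/= fmorph_div/= conjCK Nc.
have -> : - (P^* / N) * (- (P / N) * N + P) + (- (P / N) * P^* + f x x) =
          f x x - P * P^* / N by field.
by rewrite subr_ge0 ler_pdivrMr.
Qed.

Lemma form_normD x y : form_norm (x + y) <= form_norm x + form_norm y.
Proof.
rewrite -(@ler_pXn2r _ 2)// ?nnegrE ?addr_ge0 ?form_norm_ge0//.
rewrite sqrrD !form_norm_sqr formDr !formDl.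
have cs := form_cauchy_schwarz x y.
have re : f x y + f y x <= (form_norm x * form_norm y) *+ 2.
  rewrite (f_conj x y).
  have -> : f x y + (f x y)^* = 'Re (f x y) *+ 2.
    by rewrite ReE -mulr_natr divfK// pnatr_eq0.
  rewrite lerMn2r/=; apply: le_trans cs.
  exact: (leif_Re_Creal _).1.
have -> : f x x + f y x + (f x y + f y y) = f x x + (f x y + f y x) + f y y by ring.
by rewrite lerD2r lerD2l.
Qed.

Lemma form_normZ a x : form_norm (a *: x) = `|a| * form_norm x.
Proof.
rewrite /form_norm formZr formZl mulrA -normCK sqrtCM ?qualifE/= ?exprn_ge0//.
by rewrite sqrCK.
Qed.

Lemma form_norm_eq0 x : form_norm x = 0 -> x = 0.
Proof. by move=> /eqP; rewrite sqrtC_eq0 => /eqP/f_def. Qed.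

Variable phi : V -> C.
Hypothesis phi_linear : forall a x y, phi (a *: x + y) = a * phi x + phi y.

Definition form_quad x := f x x - (phi x + (phi x)^*).

Lemma form_quad_shift x v : v != 0 ->
  form_quad (- ((f x v - phi v)^* / f v v) *: v + x) =
  form_quad x - `|f x v - phi v| ^+ 2 / f v v.
Proof.
move=> v0.
have N0 : f v v != 0 by apply: contraNneq v0 => /f_def ->.
have Nc : (f v v)^* = f v v by rewrite geC0_conj.
have [D fxv] : exists D, f x v = D + phi v by exists (f x v - phi v); rewrite subrK.
rewrite fxv addrK.
rewrite /form_quad f_linear formDl formZl formDl formZl phi_linear normCK.
rewrite (f_conj x v) fxv !rmorphD/= !rmorphM/= !rmorphN/= !fmorph_div/= conjCK Nc.
by field.
Qed.

Lemma form_quad_mid x y :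
  form_quad (1 / 2 *: (x + y)) =
  (form_quad x + form_quad y) / 2 - f (x - y) (x - y) / 4.
Proof.
have h2 : (2 : C) != 0 by rewrite pnatr_eq0.
have c2 : ((1 / 2 : C))^* = 1 / 2 by rewrite geC0_conj// divr_ge0.
have phi0 : phi 0 = 0.
  by have := phi_linear (-1) 0 0; rewrite scaler0 addr0 mulN1r addNr.
have -> : x - y = x + (-1) *: y by rewrite scaleN1r.
rewrite /form_quad.
have -> : phi (1 / 2 *: (x + y)) = 1 / 2 * (phi x + phi y).
  rewrite -[X in phi X]addr0 phi_linear phi0 addr0.
  by congr (_ * _); have := phi_linear 1 x y; rewrite scale1r mul1r.
move: c2; have [h hE] : exists h : C, h = 1 / 2 by exists (1 / 2).
rewrite -!hE => hc.
rewrite !(formDr, formDl, formZl, formZr, rmorphM, rmorphD, rmorphN, rmorph1)/= hc hE.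
by field.
Qed.

End PreHilbert.

Section HilbertTheory.
Variables (R : realType) (V : hilbertType R).
Implicit Types x y : V.

Lemma ip_ge0 x : 0 <= ip x x.
Proof. by rewrite ip_norm exprn_ge0. Qed.

Lemma ip_def x : ip x x = 0 -> x = 0.
Proof. by move/eqP; rewrite ip_norm expf_eq0/= normr_eq0 => /eqP. Qed.

Lemma ip_form_norm x : form_norm ip x = `|x|.
Proof. by rewrite /form_norm ip_norm sqrCK. Qed.

Lemma ip_cauchy_schwarz x y : `|ip x y| <= `|x| * `|y|.
Proof.
rewrite -!ip_form_norm.
exact: (form_cauchy_schwarz (@ip_linear R V) (@ip_conj R V) ip_ge0 ip_def).
Qed.

End HilbertTheory.

(* [dsum d V] is the Hilbert space V \otimes C^d: columns of d vectors of V. *)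
Definition dsum (R : realType) (d : nat) (V : hilbertType R) := {ffun 'I_d -> V}.

Section DirectSum.
Variables (R : realType) (d : nat) (V : hilbertType R).
Local Notation C := (complex R).
Local Notation W := (dsum d V).

HB.instance Definition _ := GRing.Lmodule.on W.

Definition dsum_ip (x y : W) : C := \sum_i ip (x i) (y i).

Lemma dsum_ip_linear x (a : C) y z :
  dsum_ip x (a *: y + z) = a * dsum_ip x y + dsum_ip x z.
Proof.
rewrite /dsum_ip mulr_sumr -big_split/=; apply: eq_bigr => i _.
by rewrite !ffunE ip_linear.
Qed.

Lemma dsum_ip_conj x y : dsum_ip y x = (dsum_ip x y)^*.
Proof. by rewrite /dsum_ip rmorph_sum/=; apply: eq_bigr => i _; exact: ip_conj. Qed.

Lemma dsum_ip_ge0 x : 0 <= dsum_ip x x.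
Proof. by apply: sumr_ge0 => i _; exact: ip_ge0. Qed.

Lemma dsum_ip_def x : dsum_ip x x = 0 -> x = 0.
Proof.
move=> h; apply/ffunP => i; rewrite ffunE; apply: ip_def.
exact: (psumr_eq0P (fun i _ => ip_ge0 (x i)) h).
Qed.

HB.instance Definition _ := Lmodule_isNormed.Build C W
  (form_normD dsum_ip_linear dsum_ip_conj dsum_ip_ge0 dsum_ip_def)
  (form_normZ dsum_ip_linear dsum_ip_conj dsum_ip_ge0)
  (form_norm_eq0 dsum_ip_def).

Lemma dsum_ip_norm (x : W) : dsum_ip x x = `|x| ^+ 2.
Proof. by rewrite form_norm_sqr. Qed.

Lemma dsum_norm_coord (x : W) i : `|x i| <= `|x|.
Proof.
rewrite -(@ler_pXn2r _ 2)// ?nnegrE// -dsum_ip_norm -ip_norm.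
rewrite /dsum_ip (bigD1 i)//= lerDl sumr_ge0// => j _; exact: ip_ge0.
Qed.

Lemma dsum_norm_le_sum (x : W) : `|x| <= \sum_i `|x i|.
Proof.
rewrite -(@ler_pXn2r _ 2)// ?nnegrE ?sumr_ge0// -dsum_ip_norm /dsum_ip.
under eq_bigr do rewrite ip_norm.
suff [] : 0 <= \sum_i `|x i| /\ \sum_i `|x i| ^+ 2 <= (\sum_i `|x i|) ^+ 2 by [].
apply: (big_rec2 (fun b a : C => 0 <= b /\ a <= b ^+ 2)); first by rewrite expr0n.
move=> i a b _ [b0 ab]; split; first exact: addr_ge0.
rewrite sqrrD -addrA lerD2l (le_trans ab)// lerDr.
by rewrite mulrn_wge0// mulr_ge0.
Qed.

Lemma dsum_complete (F : set_system W) : ProperFilter F -> cauchy F -> cvg F.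
Proof.
move=> FF /cauchy_ballP Fc.
have coordF i : cvg ((fun x : W => x i) @ F).
  apply: cauchy_cvg; apply/cauchy_ballP => e e0.
  rewrite near_map2.
  have := Fc e e0; apply: filterS => -[x y]/=.
  rewrite -!ball_normE/=; apply: le_lt_trans.
  by have := dsum_norm_coord (x - y) i; rewrite !ffunE.
apply/cvg_ex.
exists (finfun (fun i => lim ((fun x : W => x i) @ F)) : W).
apply/cvgrPdist_lt => e e0.
have e'0 : 0 < e / d.+1%:R by rewrite divr_gt0.
have : F [set x : W | forall i,
    `|lim ((fun x : W => x i) @ F) - x i| < e / d.+1%:R].
  apply: (@filter_forall _ _ (fun i (x : W) =>
    `|lim ((fun x : W => x i) @ F) - x i| < e / d.+1%:R)) => i.
  by move/cvgrPdist_lt: (coordF i); apply.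
apply: filterS => x hx.
apply: (le_lt_trans (dsum_norm_le_sum _)).
apply: (@le_lt_trans _ _ (\sum_(i < d) e / d.+1%:R)).
  by apply: ler_sum => i _; rewrite !ffunE; exact: ltW.
rewrite sumr_const card_ord -mulrnAr -[ltRHS]mulr1 ltr_pM2l//.
by rewrite -mulr_natr mulrC ltr_pdivrMr// mul1r ltr_nat.
Qed.

HB.instance Definition _ := Uniform_isComplete.Build W dsum_complete.
HB.instance Definition _ := isHilbert.Build R W
  dsum_ip_linear dsum_ip_conj dsum_ip_norm.

End DirectSum.

Record bop (R : realType) (V W : hilbertType R) := Bop {
  bop_fun :> V -> W;
  bop_linear : linear bop_fun;
  bop_continuous : continuous bop_fun
}.

Section BoundedOperators.
Variables (R : realType) (V W : hilbertType R).
Local Notation C := (complex R).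
Local Notation L := (bop V W).
Implicit Types S T : L.

Lemma bop_ext S T : S =1 T -> S = T.
Proof.
case: S T => [f lf cf] [g lg cg] /= /funext fg.
by rewrite fg in lf cf *; congr Bop; exact: Prop_irrelevance.
Qed.

Lemma bopD T x y : T (x + y) = T x + T y.
Proof. by have := bop_linear T 1 x y; rewrite !scale1r. Qed.

Lemma bop0 T : T 0 = 0.
Proof. by have := bop_linear T (-1) 0 0; rewrite scaler0 addr0 scaleN1r addNr. Qed.

Lemma bopZ T a x : T (a *: x) = a *: T x.
Proof. by have := bop_linear T a x 0; rewrite bop0 !addr0. Qed.

Lemma bopN T x : T (- x) = - T x.
Proof. by rewrite -scaleN1r bopZ scaleN1r. Qed.

Lemma bopB T x y : T (x - y) = T x - T y.
Proof. by rewrite bopD bopN. Qed.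

Lemma bop_sum T (I : Type) (r : seq I) (P : pred I) (F : I -> V) :
  T (\sum_(i <- r | P i) F i) = \sum_(i <- r | P i) T (F i).
Proof. exact: (big_morph T (bopD T) (bop0 T)). Qed.

Definition opbound (f : V -> W) (M : R) :=
  forall x, `|f x| <= real_complex R M * `|x|.

Lemma realC_ge0 (x : C) : 0 <= x -> real_complex R (complex.Re x) = x.
Proof. by move=> /ger0_real /RRe_real. Qed.

Lemma bounded_continuous (f : V -> W) (M : R) :
  linear f -> opbound f M -> continuous f.
Proof.
move=> lf fM.
pose g : {linear V -> W} := HB.pack f (GRing.isLinear.Build _ _ _ _ f lf).
apply: (@bounded_linear_continuous C V W g).
apply/linear_boundedP; near=> r => x.
apply: (le_trans (fM x)); rewrite ler_wpM2r//.
by near: r; apply: nbhs_pinfty_ge; rewrite realE; case: (lerP 0 M) => h;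
  rewrite -(rmorph0 (real_complex R)) !lecR ?h// (ltW h) orbT.
Unshelve. all: by end_near. Qed.

Lemma bop_bounded T : exists2 M : R, 0 <= M & opbound T M.
Proof.
pose g : {linear V -> W} :=
  HB.pack (bop_fun T) (GRing.isLinear.Build _ _ _ _ _ (bop_linear T)).
have /linear_boundedP/pinfty_ex_gt0[M M0 h] :=
  @continuous_linear_bounded C V W 0 g (@bop_continuous _ _ _ T 0).
exists (complex.Re M); last by move=> x; rewrite realC_ge0 ?(ltW M0)//; exact: h.
by rewrite -lecR realC_ge0 ?ltW.
Qed.

Definition bounded_bop (f : V -> W) (M : R) (lf : linear f) (fM : opbound f M) :=
  Bop lf (bounded_continuous lf fM).

Fact bop_zero_subproof : exists T : L, T =1 fun=> 0.
Proof.
suff lb : linear (fun _ : V => 0 : W) /\ opbound (fun=> 0) 0.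
  by exists (bounded_bop lb.1 lb.2).
by split=> [a x y|x]; rewrite ?scaler0 ?addr0// normr0 rmorph0 mul0r.
Qed.

Fact bop_opp_subproof S : exists T : L, T =1 fun x => - S x.
Proof.
have [M M0 SM] := bop_bounded S.
suff lb : linear (fun x : V => - S x) /\ opbound (fun x => - S x) M.
  by exists (bounded_bop lb.1 lb.2).
by split=> [a x y|x]; rewrite ?bop_linear ?scalerN ?opprD ?normrN//; exact: SM.
Qed.

Fact bop_add_subproof S T : exists U : L, U =1 fun x => S x + T x.
Proof.
have [M M0 SM] := bop_bounded S; have [N N0 TN] := bop_bounded T.
suff lb : linear (fun x : V => S x + T x) /\ opbound (fun x => S x + T x) (M + N).
  by exists (bounded_bop lb.1 lb.2).
split=> [a x y|x]; first by rewrite !bop_linear scalerDr addrACA.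
by rewrite rmorphD/= mulrDl (le_trans (ler_normD _ _))// lerD.
Qed.

Fact bop_scale_subproof (a : C) S : exists T : L, T =1 fun x => a *: S x.
Proof.
have [M M0 SM] := bop_bounded S.
have [r ra] : exists r : R, real_complex R r = `|a|.
  by exists (complex.Re `|a|); rewrite realC_ge0.
suff lb : linear (fun x : V => a *: S x) /\ opbound (fun x => a *: S x) (r * M).
  by exists (bounded_bop lb.1 lb.2).
split=> [c x y|x]; first by rewrite bop_linear scalerDr !scalerA mulrC.
by rewrite rmorphM/= ra normrZ -mulrA ler_wpM2l.
Qed.

Definition bop_zero : L := sval (cid bop_zero_subproof).
Definition bop_opp S : L := sval (cid (bop_opp_subproof S)).
Definition bop_add S T : L := sval (cid (bop_add_subproof S T)).
Definition bop_scale a S : L := sval (cid (bop_scale_subproof a S)).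

Let zeroE x : bop_zero x = 0. Proof. exact: (svalP (cid bop_zero_subproof)). Qed.
Let oppE S x : bop_opp S x = - S x.
Proof. exact: (svalP (cid (bop_opp_subproof S))). Qed.
Let addE S T x : bop_add S T x = S x + T x.
Proof. exact: (svalP (cid (bop_add_subproof S T))). Qed.
Let scaleE a S x : bop_scale a S x = a *: S x.
Proof. exact: (svalP (cid (bop_scale_subproof a S))). Qed.

HB.instance Definition _ := gen_eqMixin L.
HB.instance Definition _ := gen_choiceMixin L.

Fact bop_addA : associative bop_add.
Proof. by move=> S T U; apply: bop_ext => x; rewrite !addE addrA. Qed.
Fact bop_addC : commutative bop_add.
Proof. by move=> S T; apply: bop_ext => x; rewrite !addE addrC. Qed.
Fact bop_add0 : left_id bop_zero bop_add.
Proof. by move=> S; apply: bop_ext => x; rewrite addE zeroE add0r. Qed.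
Fact bop_addN : left_inverse bop_zero bop_opp bop_add.
Proof. by move=> S; apply: bop_ext => x; rewrite addE oppE zeroE addNr. Qed.

HB.instance Definition _ :=
  GRing.isZmodule.Build L bop_addA bop_addC bop_add0 bop_addN.

Fact bop_scaleA a b S : bop_scale a (bop_scale b S) = bop_scale (a * b) S.
Proof. by apply: bop_ext => x; rewrite !scaleE scalerA. Qed.
Fact bop_scale1 : left_id 1 bop_scale.
Proof. by move=> S; apply: bop_ext => x; rewrite scaleE scale1r. Qed.
Fact bop_scaleDr : right_distributive bop_scale +%R.
Proof. by move=> a S T; apply: bop_ext => x; rewrite [LHS]scaleE !addE !scaleE scalerDr. Qed.
Fact bop_scaleDl S : {morph bop_scale^~ S : a b / a + b}.
Proof. by move=> a b; apply: bop_ext => x; rewrite [RHS]addE !scaleE scalerDl. Qed.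

HB.instance Definition _ := GRing.Zmodule_isLmodule.Build C L
  bop_scaleA bop_scale1 bop_scaleDr bop_scaleDl.

Lemma bop_zeroE x : (0 : L) x = 0. Proof. exact: zeroE. Qed.
Lemma bop_oppE S x : (- S) x = - S x. Proof. exact: oppE. Qed.
Lemma bop_addE S T x : (S + T) x = S x + T x. Proof. exact: addE. Qed.
Lemma bop_scaleE a S x : (a *: S) x = a *: S x. Proof. exact: scaleE. Qed.

(* The operator norm, as a complex number since norms are valued in the scalars. *)
Definition opnorm T : C :=
  real_complex R (inf [set M : R | 0 <= M /\ opbound T M]).

Lemma opnorm_has_inf T : has_inf [set M : R | 0 <= M /\ opbound T M].
Proof.
split; first by have [M M0 TM] := bop_bounded T; exists M.
by exists 0 => M [].
Qed.

Lemma opnorm_ge0 T : 0 <= opnorm T.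
Proof.
rewrite /opnorm -(rmorph0 (real_complex R)) lecR.
apply: lb_le_inf; first exact: (opnorm_has_inf T).1.
by move=> M [].
Qed.

Lemma opnormP T x : `|T x| <= opnorm T * `|x|.
Proof.
have [->|x0] := eqVneq x 0; first by rewrite bop0 !normr0 mulr0.
have nx : 0 < `|x| by rewrite normr_gt0.
rewrite -ler_pdivrMr// -[leLHS]realC_ge0 ?divr_ge0// lecR.
apply: lb_le_inf; first exact: (opnorm_has_inf T).1.
move=> M [M0 TM]; rewrite -lecR realC_ge0 ?divr_ge0// ler_pdivrMr//; exact: TM.
Qed.

Lemma opnorm_le T (M : C) : 0 <= M ->
  (forall x, `|T x| <= M * `|x|) -> opnorm T <= M.
Proof.
move=> M0 TM; rewrite -[M]realC_ge0// lecR; apply: ge_inf.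
  exact: (opnorm_has_inf T).2.
split; first by rewrite -lecR realC_ge0.
by move=> x; rewrite realC_ge0.
Qed.

Fact opnorm_normD S T : opnorm (S + T) <= opnorm S + opnorm T.
Proof.
apply: opnorm_le => [|x]; first by rewrite addr_ge0 ?opnorm_ge0.
by rewrite bop_addE mulrDl (le_trans (ler_normD _ _))// lerD// opnormP.
Qed.

Fact opnorm_eq0 T : opnorm T = 0 -> T = 0.
Proof.
move=> T0; apply: bop_ext => x; rewrite bop_zeroE; apply/eqP.
by rewrite -normr_le0 (le_trans (opnormP _ _))// T0 mul0r.
Qed.

Let opnormZ_le (a : C) T : opnorm (a *: T) <= `|a| * opnorm T.
Proof.
apply: opnorm_le => [|x]; first by rewrite mulr_ge0 ?opnorm_ge0.
by rewrite bop_scaleE normrZ -mulrA ler_wpM2l// opnormP.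
Qed.

Fact opnormZ (a : C) T : opnorm (a *: T) = `|a| * opnorm T.
Proof.
apply/le_anti; rewrite opnormZ_le/=.
have [->|a0] := eqVneq a 0; first by rewrite normr0 mul0r opnorm_ge0.
rewrite -ler_pdivlMl ?normr_gt0// -normfV.
by rewrite -[T in leLHS](scalerK a0) opnormZ_le.
Qed.

HB.instance Definition _ :=
  Lmodule_isNormed.Build C L opnorm_normD opnormZ opnorm_eq0.

End BoundedOperators.

Section Riesz.
Variables (R : realType) (V : hilbertType R).
Local Notation C := (complex R).
Implicit Types x y : V.

Lemma ip0r x : ip x 0 = 0. Proof. exact: (form0r (@ip_linear R V)). Qed.
Lemma ipDr x y z : ip x (y + z) = ip x y + ip x z.
Proof. exact: (formDr (@ip_linear R V)). Qed.
Lemma ipZr x a y : ip x (a *: y) = a * ip x y.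
Proof. exact: (formZr (@ip_linear R V)). Qed.
Lemma ipDl x y z : ip (x + y) z = ip x z + ip y z.
Proof. exact: (formDl (@ip_linear R V) (@ip_conj R V)). Qed.
Lemma ipZl a x y : ip (a *: x) y = a^* * ip x y.
Proof. exact: (formZl (@ip_linear R V) (@ip_conj R V)). Qed.
Lemma ipNr x y : ip x (- y) = - ip x y.
Proof. by rewrite -scaleN1r ipZr mulN1r. Qed.
Lemma ipNl x y : ip (- x) y = - ip x y.
Proof. by rewrite ip_conj ipNr rmorphN/= -ip_conj. Qed.
Lemma ipBr x y z : ip x (y - z) = ip x y - ip x z.
Proof. by rewrite ipDr ipNr. Qed.
Lemma ipBl x y z : ip (x - y) z = ip x z - ip y z.
Proof. by rewrite ipDl ipNl. Qed.

Lemma ip_eq x y : (forall z, ip x z = ip y z) -> x = y.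
Proof.
by move=> h; apply/subr0_eq/ip_def; rewrite ipBl h subrr.
Qed.

Lemma realC_ex (c : C) : 0 <= c -> exists2 r : R, 0 <= r & real_complex R r = c.
Proof.
move=> c0; have E := realC_ge0 c0; exists (complex.Re c) => //.
by rewrite -lecR E.
Qed.

Lemma realC_ex_gt0 (c : C) : 0 < c -> exists2 r : R, 0 < r & real_complex R r = c.
Proof.
move=> c0; have E := realC_ge0 (ltW c0); exists (complex.Re c) => //.
by rewrite -ltcR E.
Qed.

Theorem riesz (phi : V -> C) (M : C) :
  (forall a x y, phi (a *: x + y) = a * phi x + phi y) ->
  (forall x, `|phi x| <= M * `|x|) ->
  exists s, forall x, phi x = ip s x.
Proof.
move=> philin phiM.
have phi0 : phi 0 = 0.
  by have := philin (-1) 0 0; rewrite scaler0 addr0 mulN1r addNr.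
have phiD x y : phi (x + y) = phi x + phi y by rewrite -[x]scale1r philin mul1r scale1r.
have phiZ a x : phi (a *: x) = a * phi x by rewrite -[a *: x]addr0 philin phi0 addr0.
pose Q x : C := ip x x - (phi x + (phi x)^*).
pose q x : R := complex.Re (Q x).
have Qq x : real_complex R (q x) = Q x.
  apply: RRe_real; apply: rpredB; first exact/ger0_real/ip_ge0.
  by rewrite CrealE rmorphD/= conjCK addrC.
have [N N0 phiN] : exists2 N : R, 0 <= N & forall x, `|phi x| <= real_complex R N * `|x|.
  have [N N0 NM] := realC_ex (normr_ge0 M).
  exists N => // x; rewrite NM; apply: (le_trans (phiM x)).
  have := phiM x; have [->|x0] := eqVneq x 0; first by rewrite normr0 !mulr0.
  have nx : 0 < `|x| by rewrite normr_gt0.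
  move=> h; rewrite ler_pM2r//.
  have M0 : 0 <= M by rewrite -(pmulr_lge0 _ nx) (le_trans _ h).
  by rewrite ger0_norm.
have lb x : - (N ^+ 2) <= q x.
  rewrite -lecR Qq /Q ip_norm rmorphN/= rmorphXn/=.
  set n := real_complex R N.
  have re : phi x + (phi x)^* <= (n * `|x|) *+ 2.
    have -> : phi x + (phi x)^* = 'Re (phi x) *+ 2.
      by rewrite ReE -mulr_natr divfK// pnatr_eq0.
    by rewrite lerMn2r/=; apply: le_trans (phiN x); exact: (leif_Re_Creal _).1.
  rewrite -subr_ge0; apply: (@le_trans _ _ ((`|x| - n) ^+ 2)).
    by rewrite real_exprn_even_ge0// rpredB ?normr_real// ger0_real// -(rmorph0 (real_complex R)) lecR.
  rewrite -subr_ge0.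
  have -> : `|x| ^+ 2 - (phi x + (phi x)^*) - - n ^+ 2 - (`|x| - n) ^+ 2
    = (n * `|x|) *+ 2 - (phi x + (phi x)^*) by ring.
  by rewrite subr_ge0.
have qinf : has_inf (range q).
  split; first by exists (q 0), 0.
  by exists (- (N ^+ 2)) => _ [x _ <-].
pose m := inf (range q).
have mq x : m <= q x by apply: ge_inf; [exact: qinf.2|exists x].
have near_min x v (e : R) : q x < m + e ->
    `|ip x v - phi v| ^+ 2 <= real_complex R e * `|v| ^+ 2.
  move=> qx; set D := ip x v - phi v.
  have [v00|v0] := eqVneq v 0.
    by rewrite /D v00 ip0r phi0 subrr !normr0 expr0n/= mulr0.
  have v2 : 0 < `|v| ^+ 2 by rewrite exprn_gt0 ?normr_gt0.
  have vne : `|v| ^+ 2 != 0 by rewrite gt_eqF.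
  have vc : (`|v| ^+ 2)^* = `|v| ^+ 2 by rewrite geC0_conj ?ltW.
  have : Q (- (D^* / ip v v) *: v + x) = Q x - `|D| ^+ 2 / ip v v.
    exact: (form_quad_shift (@ip_linear R V) (@ip_conj R V) (@ip_ge0 R V)
      (@ip_def R V) philin x v0).
  rewrite ip_norm.
  rewrite -!Qq => E.
  have : real_complex R m <= real_complex R (q x) - `|D| ^+ 2 / `|v| ^+ 2.
    by rewrite -E lecR.
  rewrite lerBrDr -lerBrDl => h.
  rewrite -ler_pdivrMr//; apply: (le_trans h).
  by rewrite -rmorphB/= lecR lerBlDl ltW.
have close x y (e : R) : q x < m + e -> q y < m + e ->
    `|x - y| ^+ 2 <= real_complex R (e *+ 4).
  move=> qx qy.
  have := mq ((1 / 2) *: (x + y)).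
  have E : Q ((1 / 2) *: (x + y)) = (Q x + Q y) / 2 - `|x - y| ^+ 2 / 4.
    rewrite -ip_norm; exact: (form_quad_mid (@ip_linear R V) (@ip_conj R V) philin).
  rewrite -lecR Qq E -!Qq => h.
  have h4 : `|x - y| ^+ 2 / 4 <= real_complex R ((q x + q y) / 2 - m).
    rewrite rmorphB/= fmorph_div/= rmorphD/= rmorph_nat.
    by rewrite lerBrDr addrC -lerBrDr.
  rewrite ler_pdivrMr ?ltr0n// in h4; apply: (le_trans h4).
  rewrite -[4](rmorph_nat (real_complex R)) -rmorphM/= lecR.
  by lra.
pose F : set_system V :=
  filter_from [set e : R | 0 < e] (fun e => [set x | q x < m + e]).
have FF : ProperFilter F.
  apply: filter_from_proper; first apply: filter_from_filter.
  - by exists 1 => /=.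
  - move=> e f /= e0 f0; exists (Num.min e f); first by rewrite /= lt_min e0 f0.
    by move=> x /=; rewrite -ltrBlDl lt_min !ltrBlDl => /andP[].
  - move=> e /= e0.
    have [_ [x _ <-] h] := inf_adherent e0 qinf.
    by exists x.
have FC : cauchy F.
  apply/cauchy_exP => e e0.
  have [r r0 er] := realC_ex_gt0 e0.
  have r20 : 0 < r ^+ 2 / 8 by rewrite divr_gt0 ?exprn_gt0.
  have [_ [x _ <-] qx] := inf_adherent r20 qinf.
  exists x, (r ^+ 2 / 8) => // y /= qy.
  rewrite -ball_normE/= -(@ltr_pXn2r _ 2)// ?nnegrE ?normr_ge0 ?(ltW e0)//.
  apply: (le_lt_trans (close _ _ _ qx qy)).
  rewrite -er -rmorphXn/= ltcR; have := exprn_gt0 2 r0.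
  by move: (r ^+ 2) => t t0; lra.
have /cvg_ex[s Fs] : cvg F by apply: cauchy_cvg FC.
exists s => v; apply/eqP; rewrite eq_sym -subr_eq0 -normr_le0.
apply/ler_addgt0Pl => e e0; rewrite addr0.
have v1 : 0 < `|v| + 1 by rewrite ltr_wpDl.
set d := e / 2 / (`|v| + 1).
have d0 : 0 < d by rewrite !divr_gt0.
have [r r0 rd] := realC_ex_gt0 d0.
have F1 : F [set x | q x < m + r ^+ 2] by exists (r ^+ 2) => //=; exact: exprn_gt0.
have F2 : F [set x | `|s - x| < d].
  have := Fs _ (nbhsx_ballx s d d0); rewrite /= -ball_normE; exact.
have [x [/= x1 x2]] := @filter_ex _ _ FF _ (filterI F1 F2).
have -> : ip s v - phi v = ip (s - x) v + (ip x v - phi v) by rewrite ipBl; ring.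
have dv : d * `|v| <= e / 2.
  rewrite /d -[leRHS]mulr1 -mulrA ler_pM2l ?divr_gt0// ler_pdivrMl// mulr1.
  by rewrite lerDl.
apply: (le_trans (ler_normD _ _)).
have -> : e = e / 2 + e / 2 by field.
apply: lerD.
  apply: (le_trans (ip_cauchy_schwarz _ _)); apply: le_trans dv.
  by rewrite ler_wpM2r// ltW.
have dv0 : 0 <= d * `|v| by apply: mulr_ge0 => //; exact: ltW.
apply: le_trans dv; rewrite -(@ler_pXn2r _ 2) ?nnegrE ?normr_ge0 ?dv0//.
have r2 : real_complex R (r ^+ 2) = d ^+ 2.
  by rewrite -rd; exact: (rmorphXn (real_complex R)).
by rewrite exprMn -r2; exact: (near_min x v _ x1).
Qed.

End Riesz.

Section Operations.
Variable R : realType.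
Local Notation C := (complex R).

Fact bop_id_subproof (V : hilbertType R) : exists T : bop V V, T =1 id.
Proof.
suff lb : linear (id : V -> V) /\ opbound (id : V -> V) 1.
  by exists (bounded_bop lb.1 lb.2).
by split=> // x; rewrite rmorph1 mul1r.
Qed.

Fact bop_comp_subproof (U V W : hilbertType R) (S : bop V W) (T : bop U V) :
  exists Q : bop U W, Q =1 S \o T.
Proof.
have [M M0 SM] := bop_bounded S; have [N N0 TN] := bop_bounded T.
suff lb : linear (S \o T : U -> W) /\ opbound (S \o T) (M * N).
  by exists (bounded_bop lb.1 lb.2).
split=> [a x y|x] /=; first by rewrite !bop_linear.
rewrite rmorphM/= -mulrA; apply: (le_trans (SM _)); apply: ler_wpM2l (TN x).
by rewrite -(rmorph0 (real_complex R)) lecR.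
Qed.

Fact adj_subproof (V W : hilbertType R) (T : bop V W) :
  exists S : bop W V, forall x y, ip (T x) y = ip x (S y).
Proof.
have [M M0 TM] := bop_bounded T.
have M0' : 0 <= real_complex R M by rewrite -(rmorph0 (real_complex R)) lecR.
have /choice[S SP] : forall y, exists s, forall x, ip y (T x) = ip s x.
  move=> y; apply: (@riesz R V (fun x => ip y (T x)) (`|y| * real_complex R M)).
    by move=> a u v; rewrite bop_linear ip_linear.
  move=> x; apply: (le_trans (ip_cauchy_schwarz _ _)).
  by rewrite -mulrA ler_wpM2l.
have SP' x y : ip (T x) y = ip x (S y).
  by rewrite ip_conj SP -ip_conj.
suff lb : linear S /\ opbound S M.
  by exists (bounded_bop lb.1 lb.2) => x y; rewrite SP'.
split=> [a u v|y].
  by apply: ip_eq => z; rewrite -SP !ipDl !ipZl !SP.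
have [->|S0] := eqVneq (S y) 0; first by rewrite normr0 mulr_ge0.
have nS : 0 < `|S y| by rewrite normr_gt0.
rewrite -(ler_pM2l nS) -expr2 -ip_norm -SP.
apply: (@le_trans _ _ `|ip y (T (S y))|).
  by rewrite ger0_norm// SP ip_ge0.
apply: (le_trans (ip_cauchy_schwarz _ _)).
have -> : `|S y| * (real_complex R M * `|y|) = `|y| * (real_complex R M * `|S y|).
  by ring.
by rewrite ler_wpM2l.
Qed.

Definition bid (V : hilbertType R) : bop V V := sval (cid (bop_id_subproof V)).
Definition bcomp (U V W : hilbertType R) (S : bop V W) (T : bop U V) : bop U W :=
  sval (cid (bop_comp_subproof S T)).
Definition adj (V W : hilbertType R) (T : bop V W) : bop W V :=
  sval (cid (adj_subproof T)).

Lemma bidE (V : hilbertType R) (x : V) : bid V x = x.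
Proof. exact: (svalP (cid (bop_id_subproof V))). Qed.

Lemma bcompE (U V W : hilbertType R) (S : bop V W) (T : bop U V) x :
  bcomp S T x = S (T x).
Proof. exact: (svalP (cid (bop_comp_subproof S T))). Qed.

Lemma adjP (V W : hilbertType R) (T : bop V W) x y : ip (T x) y = ip x (adj T y).
Proof. exact: (svalP (cid (adj_subproof T))). Qed.

(* The inverse in L(V); it is 0 when T is not invertible. *)
Definition binv (V : hilbertType R) (T : bop V V) : bop V V :=
  xget 0 [set S | bcomp S T = bid V /\ bcomp T S = bid V].

Definition dsum_map_fun (d : nat) (V W : hilbertType R) (T : V -> W) :
  dsum d V -> dsum d W := fun x => [ffun j => T (x j)].

Fact dsum_map_subproof (d : nat) (V W : hilbertType R) (T : bop V W) :
  exists S : bop (dsum d V) (dsum d W), forall x j, S x j = T (x j).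
Proof.
have [M M0 TM] := bop_bounded T.
have M0' : 0 <= real_complex R M by rewrite -(rmorph0 (real_complex R)) lecR.
suff lb : linear (dsum_map_fun T : dsum d V -> dsum d W) /\
    opbound (dsum_map_fun T : dsum d V -> dsum d W) M.
  by exists (bounded_bop lb.1 lb.2) => x j; rewrite ffunE.
split=> [a x y|x]; first by apply/ffunP => j; rewrite !ffunE bop_linear.
rewrite -(@ler_pXn2r _ 2)// ?nnegrE ?mulr_ge0// exprMn -!dsum_ip_norm /dsum_ip mulr_sumr.
by apply: ler_sum => j _; rewrite ffunE !ip_norm -exprMn ler_pXn2r ?nnegrE ?mulr_ge0.
Qed.

Fact dsum_col_subproof (d : nat) (V W : hilbertType R) (T : 'I_d -> bop V W) :
  exists S : bop V (dsum d W), forall x j, S x j = T j x.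
Proof.
pose f (x : V) : dsum d W := [ffun j => T j x].
have /choice[M TM] : forall j, exists m : R, 0 <= m /\ opbound (T j) m.
  by move=> j; have [m m0 mP] := bop_bounded (T j); exists m.
suff lb : linear f /\ opbound f (\sum_j M j).
  by exists (bounded_bop lb.1 lb.2) => x j; rewrite ffunE.
split=> [a x y|x]; first by apply/ffunP => j; rewrite !ffunE bop_linear.
apply: (le_trans (dsum_norm_le_sum _)).
rewrite rmorph_sum/= mulr_suml; apply: ler_sum => j _; rewrite ffunE.
exact: (TM j).2.
Qed.

(* T \otimes I_{C^d} *)
Definition dsum_map (d : nat) (V W : hilbertType R) (T : bop V W) :
  bop (dsum d V) (dsum d W) := sval (cid (dsum_map_subproof d T)).

(* The column operator (T_1, ..., T_d)^T. *)
Definition dsum_col (d : nat) (V W : hilbertType R) (T : 'I_d -> bop V W) :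
  bop V (dsum d W) := sval (cid (dsum_col_subproof T)).

Lemma dsum_mapE (d : nat) (V W : hilbertType R) (T : bop V W) x j :
  dsum_map d T x j = T (x j).
Proof. exact: (svalP (cid (dsum_map_subproof d T))). Qed.

Lemma dsum_colE (d : nat) (V W : hilbertType R) (T : 'I_d -> bop V W) x j :
  dsum_col T x j = T j x.
Proof. exact: (svalP (cid (dsum_col_subproof T))). Qed.

End Operations.

Notation "S ∘ T" := (bcomp S T) (at level 40, left associativity) : ring_scope.
Notation "T ^†" := (adj T) (at level 1, format "T ^†") : ring_scope.

Section Operators.
Variable R : realType.
Local Notation C := (complex R).

Definition unitary (V : hilbertType R) (A : bop V V) :=
  A^† ∘ A = bid V /\ A ∘ A^† = bid V.

Definition lspan (V : lmodType C) (S : set V) : set V :=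
  [set x | exists n (a : 'I_n -> C) (s : 'I_n -> V),
     (forall i, S (s i)) /\ x = \sum_i a i *: s i].

Definition closed_span (V : normedModType C) (S : set V) : set V :=
  closure (lspan S).

Definition partial_isometry_on (V W : hilbertType R) (T : bop V W) (M : set V) :=
  (forall x, M x -> `|T x| = `|x|) /\
  (forall x, (forall y, M y -> ip y x = 0) -> T x = 0).

Lemma bcompA (V1 V2 V3 V4 : hilbertType R)
    (S : bop V3 V4) (T : bop V2 V3) (Q : bop V1 V2) : S ∘ (T ∘ Q) = S ∘ T ∘ Q.
Proof. by apply: bop_ext => x; rewrite !bcompE. Qed.

Lemma bcomp1 (V W : hilbertType R) (T : bop V W) : T ∘ bid V = T.
Proof. by apply: bop_ext => x; rewrite bcompE bidE. Qed.

Lemma adj_unique (V W : hilbertType R) (T : bop V W) (S : bop W V) :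
  (forall x y, ip (T x) y = ip x (S y)) -> T^† = S.
Proof.
by move=> TS; apply: bop_ext => y; apply: ip_eq => x; rewrite ip_conj -adjP TS -ip_conj.
Qed.

Lemma adjK (V W : hilbertType R) (T : bop V W) : T^†^† = T.
Proof. by apply: adj_unique => x y; rewrite ip_conj -adjP -ip_conj. Qed.

Lemma adj_comp (V1 V2 V3 : hilbertType R) (S : bop V2 V3) (T : bop V1 V2) :
  (S ∘ T)^† = T^† ∘ S^†.
Proof. by apply: adj_unique => x y; rewrite !bcompE !adjP. Qed.

End Operators.

Record unit_ball (R : realType) (d : nat) := UnitBall {
  ball_pt :> 'rV[complex R]_d;
  ball_ptP : \sum_j `|ball_pt 0 j| ^+ 2 < 1
}.

Section HilbertFunctionSpaces.
Variables (R : realType) (d : nat) (H : hilbertType R).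
Local Notation C := (complex R).
Local Notation B := (unit_ball R d).
Local Notation I := (bid H).
Implicit Types (z w : B) (b c : B -> bop H H).

Fact origin_subproof : \sum_j `|(0 : 'rV[C]_d) 0 j| ^+ 2 < 1.
Proof. by rewrite big1 ?ltr01// => j _; rewrite mxE normr0 expr0n. Qed.

Definition origin : B := UnitBall origin_subproof.

(* zw^* *)
Definition pairing z w : C := \sum_j z 0 j * (w 0 j)^*.

(* A Hilbert space of H-valued functions on the ball (a vector f is the
   function z |-> ev z f) with bounded evaluations and reproducing kernel k. *)
Record rkhs (k : B -> B -> bop H H) := RKHS {
  rkhs_space :> hilbertType R;
  ev : B -> bop rkhs_space H;
  ev_inj : forall f g, (forall z, ev z f = ev z g) -> f = g;
  ev_kernel : forall z w, ev z ∘ (ev w)^† = k z w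
}.

Definition kerop k (K : rkhs k) w : bop H K := (ev K w)^†.

(* w^*k_w : H -> K \otimes C^d *)
Definition wkerop k (K : rkhs k) w : bop H (dsum d K) :=
  dsum_col (fun j => (w 0 j)^* *: kerop K w).

(* The kernel of H^2_d \otimes H. *)
Definition drury_arveson z w : bop H H := (1 - pairing z w)^-1 *: I.

(* Membership in [H^oo_d \otimes L(H)]_1: multiplication by b is an operator of
   norm at most 1 on H^2_d \otimes H. *)
Definition schur_class (H2 : rkhs drury_arveson) b :=
  exists M : bop H2 H2, `|M| <= 1 /\ forall z, ev H2 z ∘ M = b z ∘ ev H2 z.

Definition purely_contractive b := forall z, `|b z| < 1.

Definition dbr_kernel b z w : bop H H :=
  (1 - pairing z w)^-1 *: (I - b z ∘ (b w)^†).

Definition herglotz_fun c z : bop H H := binv (I - c z) ∘ (I + c z).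

Definition herglotz_kernel c z w : bop H H :=
  (1 / 2 * (1 - pairing z w)^-1) *: (herglotz_fun c z + (herglotz_fun c w)^†).

Lemma dbr_kernel_unitary b (A : bop H H) : unitary A ->
  dbr_kernel (fun z => b z ∘ A^†) = dbr_kernel b.
Proof.
move=> [AA _]; apply/funext => z; apply/funext => w.
by rewrite /dbr_kernel adj_comp adjK bcompA -(bcompA (b z)) AA bcomp1.
Qed.

Definition is_herglotz_isometry k (L : rkhs k) (V : bop (dsum d L) L) :=
  partial_isometry_on V (closed_span [set x | exists w h, x = wkerop L w h]) /\
  forall w h, V (wkerop L w h) = kerop L w h - kerop L origin h.

Definition is_dbr_to_herglotz c k l (K : rkhs k) (L : rkhs l) (U : bop K L) :=
  forall f z, ev L z (U f) = binv (I - c z) (ev K z f).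

End HilbertFunctionSpaces.

(* The full Fock space over C^d, through its orthonormal basis
   e_{i1} \otimes ... \otimes e_{in} indexed by words, with the left creation
   operators. *)
Record fock (R : realType) (d : nat) := Fock {
  fock_space :> hilbertType R;
  word : seq 'I_d -> fock_space;
  word_orthonormal : forall u v, ip (word u) (word v) = (u == v)%:R;
  word_total : closed_span (range word) = setT;
  lcreate : 'I_d -> bop fock_space fock_space;
  lcreate_word : forall j u, lcreate j (word u) = word (j :: u)
}.

Section FreeDisk.
Variables (R : realType) (d : nat) (F : fock R d) (H : hilbertType R).
Local Notation C := (complex R).
Local Notation B := (unit_ball R d).
Local Notation LF := (bop F F).
Implicit Types (z w : B) (c : B -> bop H H) (mu : LF -> bop H H).

(* Lz^* and zL^* *)
Definition Lzs z : LF := \sum_j (z 0 j)^* *: lcreate F j.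
Definition zLs z : LF := \sum_j z 0 j *: (lcreate F j)^†.

Definition free_szego : set LF :=
  closed_span [set p | exists z, p = binv (bid F - Lzs z)].

Definition free_system : set LF :=
  closure [set t | exists p q, [/\ free_szego p, free_szego q & t = p + q^†]].

(* Only the values of mu on free_system matter. *)
Definition completely_positive mu :=
  (forall (a : C) s t, free_system s -> free_system t ->
     mu (a *: s + t) = a *: mu s + mu t) /\
  (forall n (t : 'I_n -> 'I_n -> LF),
     (forall i j, free_system (t i j)) ->
     (forall x : 'I_n -> F, 0 <= \sum_i \sum_j ip (x i) (t i j (x j))) ->
     forall h : 'I_n -> H, 0 <= \sum_i \sum_j ip (h i) (mu (t i j) (h j))).

Definition is_herglotz_map c mu :=
  completely_positive mu /\
  forall z w, mu (binv (bid F - zLs z) ∘ binv (bid F - Lzs w)) =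
              herglotz_kernel c z w.

(* The completion of S \otimes H modulo null vectors: [tensor p h] is the class
   of p \otimes h, meaningful for p in S only. *)
Record P2space mu := P2Space {
  P2_space :> hilbertType R;
  tensor : LF -> H -> P2_space;
  tensor_linear_l : forall (a : C) p q h, free_szego p -> free_szego q ->
    tensor (a *: p + q) h = a *: tensor p h + tensor q h;
  tensor_linear_r : forall (a : C) p h g, free_szego p ->
    tensor p (a *: h + g) = a *: tensor p h + tensor p g;
  tensor_ip : forall p q h g, free_szego p -> free_szego q ->
    ip (tensor p h) (tensor q g) = ip h (mu (p^† ∘ q) g);
  tensor_total :
    closed_span [set x | exists p h, free_szego p /\ x = tensor p h] = setT
}.

Definition is_weighted_cauchy c mu (P : P2space mu) k (K : rkhs k)
    (Fc : bop P K) :=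
  forall p h z, free_szego p ->
    ev K z (Fc (tensor P p h)) = (bid H - c z) (mu (binv (bid F - zLs z) ∘ p) h).

End FreeDisk.

Section Gleason.
Variables (R : realType) (d : nat) (H : hilbertType R).
Local Notation B := (unit_ball R d).
Variable b : B -> bop H H.

(* The minimal contractive Gleason solution for b, from V^b and U_b. *)
Definition gleason_min l (K : rkhs (dbr_kernel b)) (L : rkhs l)
    (V : bop (dsum d L) L) (U : bop K L) : bop H (dsum d K) :=
  dsum_map d (U^†) ∘ V^† ∘ kerop L (origin R d) ∘ (bid H - b (origin R d)).

(* X is determined by its adjoint on the dense span of the ranges of the k_w:
   it is the minimal contractive Gleason solution for K(b), given the
   minimal one Bb for b. *)
Definition is_gleason_min_space (K : rkhs (dbr_kernel b))
    (Bb : bop H (dsum d K)) (X : bop (dsum d K) K) :=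
  forall w, X^† ∘ kerop K w = wkerop K w - Bb ∘ (b w)^†.

End Gleason.

(* C^* V (C \otimes I), where C = U F is the Cauchy transform. *)
Definition compressed_shift (R : realType) (d : nat) (P K L : hilbertType R)
    (V : bop (dsum d L) L) (U : bop K L) (F : bop P K) : bop (dsum d P) P :=
  (U ∘ F)^† ∘ V ∘ dsum_map d (U ∘ F).

(* Main.v *)
Require Import Defs.
From mathcomp Require Import all_boot all_order all_algebra.
From mathcomp Require Import complex ring.
From mathcomp Require Import all_classical all_reals.
From mathcomp Require Import topology normedtype.
From mathcomp Require Import sequences.

Set Implicit Arguments.
Unset Strict Implicit.
Unset Printing Implicit Defensive.

Import Order.TTheory GRing.Theory Num.Theory.
Import numFieldNormedType.Exports.
Local Open Scope classical_set_scope.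
Local Open Scope ring_scope.

(** Write c = b A^*, g(z) = (I - c(z))^-1, and let U, V, F belong to c.

    Since F is a coisometry onto K(b), conjugating the definition of the
    compressed shift by F cancels the Cauchy transforms and leaves, on K(b),
    the operator W U with W = (U^* (x) I) V^* : L(c) -> K(b) (x) C^d
    ([cauchy_coisometry]).  So the claim is an identity between bounded
    operators on K(b), and it is enough to test it on the kernels k_w h.

    All the rest follows from K^c(z,w) = g(z) k^b(z,w) g(w)^*
    ([herglotz_dbr_kernel]).  It makes U exchange kernels,
    U k_w = K_w (I - c(w))^*, and together with V^* (K_w - K_0) = w^* K_w
    ([herglotz_isometry_adj]) it gives
      W U k_w = w^* k_w + W K_0 (I - c(w))^*.

    The remaining constant W K_0 is where b and bA^* are compared.  The range of
    W lies in the closed span of the w^* k_w h, a subspace that depends on K(b)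
    only, so W x is determined by its inner products with these vectors, and
      < w^* k_w h, W K_0 (I - c(0)) u > = < h, (c(w) - c(0)) u >
    ([ip_wkerop_gleason]).  For b and for bA^* these right-hand sides match after
    replacing u by A^* u, which says that the minimal Gleason solution for bA^* is
    B A^* ([pullback_eq]).  Hence W K_0 = B A^* g(0), and the identity on k_w h
    reduces to A^* g(0) (A - b(0)) = I, which is the unitarity of A. *)

(** * Bounded operators and their inverses *)

Section Operators.
Variable R : realType.
Local Notation C := (complex R).
Implicit Types V W : hilbertType R.

Lemma ip0l V (x : V) : ip 0 x = 0.
Proof. by rewrite ip_conj ip0r rmorph0. Qed.

Lemma ip_eqr V (x y : V) : (forall z, ip z x = ip z y) -> x = y.
Proof. by move=> h; apply: ip_eq => z; rewrite ip_conj h -ip_conj. Qed.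

Lemma adj_ip V W (T : bop V W) x y : ip (T^† y) x = ip y (T x).
Proof. by rewrite adjP adjK. Qed.

Lemma adj_id V : (bid V)^† = bid V.
Proof. by apply: adj_unique => x y; rewrite !bidE. Qed.

Lemma adj_sub V W (S T : bop V W) : (S - T)^† = S^† - T^†.
Proof.
apply: adj_unique => x y.
by rewrite !bop_addE !bop_oppE ipBl ipBr !adjP.
Qed.

Lemma adj_scale V W (a : C) (T : bop V W) : (a *: T)^† = a^* *: T^†.
Proof. by apply: adj_unique => x y; rewrite !bop_scaleE ipZl ipZr adjP. Qed.

Lemma adj0 V W : (0 : bop V W)^† = 0.
Proof. by apply: adj_unique => x y; rewrite !bop_zeroE ip0l ip0r. Qed.

Lemma adj_add V W (S T : bop V W) : (S + T)^† = S^† + T^†.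
Proof. by apply: adj_unique => x y; rewrite !bop_addE ipDl ipDr !adjP. Qed.

Lemma adj_sum V W (I : Type) (r : seq I) (P : pred I) (T : I -> bop V W) :
  (\sum_(i <- r | P i) T i)^† = \sum_(i <- r | P i) (T i)^†.
Proof. exact: (big_morph (@adj R V W) (@adj_add V W) (adj0 V W)). Qed.

Lemma dsum_ipE d V (x y : dsum d V) : ip x y = \sum_j ip (x j) (y j).
Proof. by []. Qed.

Lemma adj_dsum_map d V W (T : bop V W) : (dsum_map d T)^† = dsum_map d T^†.
Proof.
apply: adj_unique => x y; rewrite !dsum_ipE; apply: eq_bigr => j _.
by rewrite !dsum_mapE adjP.
Qed.

Lemma dsum_map_comp d V1 V2 V3 (S : bop V2 V3) (T : bop V1 V2) :
  dsum_map d (S ∘ T) = dsum_map d S ∘ dsum_map d T.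
Proof.
by apply: bop_ext => x; apply/ffunP => j; rewrite bcompE !dsum_mapE bcompE.
Qed.

(** This is how [partial_isometry_on] is used: vanishing on an orthogonal
    complement can be checked on a spanning family. *)
Lemma ortho_closed_span V (S : set V) (x : V) :
  (forall s, S s -> ip s x = 0) -> forall y, closed_span S y -> ip y x = 0.
Proof.
move=> Sx y Sy; apply/eqP; rewrite -normr_le0; apply/ler_addgt0Pl => e e0.
rewrite addr0; have x1 : 0 < `|x| + 1 by rewrite ltr_wpDl.
have e1 : 0 < e / (`|x| + 1) by rewrite divr_gt0.
have [_ [[n [a [s [sS ->]]]]]] := Sy _ (nbhsx_ballx y _ e1).
rewrite -ball_normE/=; set t := \sum_i _ => yt.
have t0 : ip t x = 0.
  rewrite ip_conj /t (big_morph (ip x) (ipDr x) (ip0r x)) big1 ?rmorph0// => i _.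
  by rewrite ipZr ip_conj Sx// rmorph0 mulr0.
rewrite -[ip y x]subr0 -t0 -ipBl (le_trans (ip_cauchy_schwarz _ _))//.
apply: (@le_trans _ _ (e / (`|x| + 1) * (`|x| + 1))); last by rewrite divfK ?gt_eqF.
by apply: ler_pM => //; [exact: ltW|rewrite lerDl].
Qed.

Lemma total_ip_eq V (S : set V) (x y : V) : closed_span S = setT ->
  (forall s, S s -> ip s x = ip s y) -> x = y.
Proof.
move=> ST xy; apply/subr0_eq/ip_def.
apply: (@ortho_closed_span _ S); last by rewrite ST.
by move=> s /xy; rewrite ipBr => ->; rewrite subrr.
Qed.

Definition invertible V (T : bop V V) :=
  exists S, S ∘ T = bid V /\ T ∘ S = bid V.

Lemma binvP V (T : bop V V) : invertible T ->
  binv T ∘ T = bid V /\ T ∘ binv T = bid V.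
Proof.
move=> TS.
by have := @xgetPex _ 0 [set S | S ∘ T = bid V /\ T ∘ S = bid V] TS.
Qed.

Lemma binvK V (T : bop V V) : invertible T -> forall x, binv T (T x) = x.
Proof. by move=> /binvP[h _] x; rewrite -bcompE h bidE. Qed.

Lemma binvKr V (T : bop V V) : invertible T -> forall x, T (binv T x) = x.
Proof. by move=> /binvP[_ h] x; rewrite -bcompE h bidE. Qed.

Lemma binv_eq V (T S : bop V V) : S ∘ T = bid V -> T ∘ S = bid V -> binv T = S.
Proof.
move=> ST TS; have h : invertible T by exists S.
by apply: bop_ext => x; rewrite -[in LHS](bidE x) -TS bcompE binvK.
Qed.

Lemma adj_invertible V (T : bop V V) : invertible T -> invertible T^†.
Proof.
by move=> [S [ST TS]]; exists S^†; rewrite -!adj_comp ST TS adj_id.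
Qed.

(** T and its adjoint are invertible together; when they are not, both sides are
    the default value 0.  The resolvents of the creation
    operators can thus be conjugated without estimating the norm of Lz^*. *)
Lemma adj_binv V (T : bop V V) : (binv T)^† = binv T^†.
Proof.
have [h|h] := pselect (invertible T).
  have [h1 h2] := binvP h; symmetry.
  by apply: binv_eq; rewrite -adj_comp ?h1 ?h2 adj_id.
have h' : ~ invertible T^† by move/adj_invertible; rewrite adjK.
by rewrite /binv !xgetPN ?adj0// => S ?; [apply: h'|apply: h]; exists S.
Qed.

(** The Neumann series of (I - c)^-1, read through its partial sums: they solve
    x - c x = y up to an error c^n y.  As I - c is bounded below by 1 - |c|, the
    sets of approximate solutions form a Cauchy filter, whose limit solves the
    equation exactly. *)
Lemma id_sub_contraction_surj V (c : bop V V) :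
  `|c| < 1 -> forall y, exists x, x - c x = y.
Proof.
move=> c1 y.
have [q q0 qc] := realC_ex (normr_ge0 c).
have q1 : q < 1 by rewrite -ltcR qc rmorph1.
have cq x : `|c x| <= real_complex R q * `|x| by rewrite qc; exact: opnormP.
have [m m0 my] := realC_ex (normr_ge0 y).
have approx (e : C) : 0 < e -> exists x, `|y - (x - c x)| < e.
  move=> /realC_ex_gt0[r r0 <-].
  pose u n := iter n (fun x => y + c x) 0.
  have uE n : y - (u n - c (u n)) = iter n c y.
    elim: n => [|n IH]; first by rewrite /= bop0 !subr0.
    rewrite iterS -IH /u iterS -/(u n) !(bopB, bopD) !opprB.
    by rewrite addrC opprD addrA addrAC subrK -!addrA bopB.
  have un n : `|y - (u n - c (u n))| <= real_complex R (q ^+ n * m).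
    rewrite uE; elim: n => [|n IH]; first by rewrite expr0 mul1r my.
    rewrite iterS (le_trans (cq _))// exprS -mulrA rmorphM/= ler_wpM2l//.
    by rewrite -(rmorph0 (real_complex R)) lecR.
  have qm : (q ^+ n * m) @[n --> \oo] --> (0 : R).
    rewrite -(mul0r m); apply: cvgMl; apply: cvg_expr.
    by rewrite ger0_norm.
  move/cvgrPdist_lt: qm => /(_ _ r0)[N _ /(_ N (leqnn N))].
  rewrite sub0r normrN => h; exists (u N); apply: (le_lt_trans (un N)).
  by rewrite ltcR (le_lt_trans _ h)// ler_norm.
(* The approximate solutions of x - c x = y, indexed by the error allowed. *)
pose F : set_system V :=
  filter_from [set e : C | 0 < e] (fun e => [set x | `|y - (x - c x)| < e]).
have FF : ProperFilter F.
  apply: filter_from_proper; first apply: filter_from_filter.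
  - by exists 1 => /=.
  - move=> e f /= /realC_ex_gt0[r r0 <-] /realC_ex_gt0[s s0 <-].
    exists (real_complex R (Num.min r s)).
      by rewrite /= -(rmorph0 (real_complex R)) ltcR lt_min r0.
    move=> x /= h; split; apply: (lt_le_trans h); rewrite lecR ge_min lexx ?orbT//.
  - by move=> e /= /approx[x]; exists x.
have q'0 : 0 < 1 - real_complex R q by rewrite qc subr_gt0.
have close x x' : (1 - real_complex R q) * `|x - x'| <=
    `|y - (x - c x)| + `|y - (x' - c x')|.
  have -> : `|y - (x - c x)| + `|y - (x' - c x')| =
      `|y - (x' - c x')| + `|- (y - (x - c x))| by rewrite normrN addrC.
  apply: le_trans (ler_normD _ _).
  have -> : y - (x' - c x') - (y - (x - c x)) = (x - x') - c (x - x').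
    have E v v' : y - v - (y - v') = v' - v by rewrite opprB addrC addrA subrK.
    by rewrite E bopB !opprD addrACA.
  by rewrite mulrBl mul1r (le_trans _ (lerB_dist _ _))// lerB.
have FC : cauchy F.
  apply/cauchy_exP => e e0.
  have e'0 : 0 < e * (1 - real_complex R q) / 2 by rewrite divr_gt0 ?mulr_gt0.
  have [x xe] := approx _ e'0.
  exists x, (e * (1 - real_complex R q) / 2) => // x' /= x'e.
  rewrite -ball_normE/= -(ltr_pM2l q'0); apply: (le_lt_trans (close _ _)).
  by rewrite mulrC [ltRHS]splitr ltrD.
have /cvg_ex[s Fs] : cvg F by apply: cauchy_cvg FC.
exists s; apply/eqP; rewrite eq_sym -subr_eq0 -normr_le0.
apply/ler_addgt0Pl => e e0; rewrite addr0.
have e2 : 0 < e / 2 by rewrite divr_gt0.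
have Tcont : (fun x => x - c x) @ F --> s - c s.
  by apply: (cvgB Fs); apply: (cvg_comp _ _ Fs); exact: bop_continuous.
have F1 : F [set x | `|y - (x - c x)| < e / 2] by exists (e / 2).
have F2 : F [set x | `|s - c s - (x - c x)| < e / 2].
  by move/cvgrPdist_lt: Tcont; apply.
have [x [/= x1 x2]] := @filter_ex _ _ FF _ (filterI F1 F2).
have -> : y - (s - c s) = y - (x - c x) + (x - c x - (s - c s)).
  by rewrite [RHS]addrA subrK.
rewrite (le_trans (ler_normD _ _))// [X in _ + X]distrC [leRHS]splitr.
by rewrite lerD// ltW.
Qed.

Lemma id_sub_contraction_invertible V (c : bop V V) :
  `|c| < 1 -> invertible (bid V - c).
Proof.
move=> c1; have T x : (bid V - c) x = x - c x by rewrite bop_addE bop_oppE bidE.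
have inj x : x - c x = 0 -> x = 0.
  move/eqP; rewrite subr_eq0 => /eqP xc; apply/eqP; rewrite -normr_le0.
  have := opnormP c x; rewrite -xc => h.
  have {h} : (1 - `|c|) * `|x| <= 0 by rewrite mulrBl mul1r subr_le0.
  by rewrite pmulr_rle0// subr_gt0.
have inj2 x x' : x - c x = x' - c x' -> x = x'.
  move=> xx'; apply/subr0_eq/inj.
  have -> : x - x' - c (x - x') = x - c x - (x' - c x').
    by rewrite bopB !opprD addrACA.
  by rewrite xx' subrr.
have /choice[S SP] := id_sub_contraction_surj c1.
have d0 : 0 < 1 - `|c| by rewrite subr_gt0.
have [M M0 MP] : exists2 M : R, 0 < M & real_complex R M = (1 - `|c|)^-1.
  by apply: realC_ex_gt0; rewrite invr_gt0.
suff lb : linear S /\ opbound S M.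
  exists (bounded_bop lb.1 lb.2); split; apply: bop_ext => x.
    by rewrite bcompE bidE T /=; apply: inj2; rewrite SP.
  by rewrite bcompE bidE T /= SP.
split=> [a x x'|x].
  apply: inj2; rewrite SP bopD bopZ opprD addrACA -scalerBr.
  by rewrite !SP.
rewrite MP ler_pdivlMl//.
rewrite mulrBl mul1r -{3}(SP x) (le_trans _ (lerB_dist _ _))// lerB//.
exact: opnormP.
Qed.

Lemma opnorm_comp_unitary V (T A : bop V V) :
  unitary A -> `|T ∘ A^†| <= `|T|.
Proof.
move=> [_ AA]; apply: opnorm_le => // x; rewrite bcompE (le_trans (opnormP _ _))//.
apply: ler_wpM2l; first exact: opnorm_ge0.
by rewrite -(@ler_pXn2r _ 2) ?nnegrE// -!ip_norm adj_ip -bcompE AA bidE.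
Qed.

End Operators.

(** * Kernels of vector-valued function spaces *)

Section Kernels.
Variables (R : realType) (d : nat) (H : hilbertType R).
Local Notation C := (complex R).
Local Notation B := (unit_ball R d).
Local Notation I := (bid H).
Local Notation "0b" := (origin R d).
Implicit Types z w : B.

(** On the open ball |zw^*| < 1, by |x y| <= (|x|^2 + |y|^2) / 2 termwise. *)
Lemma pairing_neq1 z w : 1 - pairing z w != 0.
Proof.
rewrite subr_eq0; apply: contraTneq isT => p1.
have : `|pairing z w| < 1.
  have amgm (x y : C) : `|x * y^*| <= (`|x| ^+ 2 + `|y| ^+ 2) / 2.
    rewrite normrM norm_conjC ler_pdivlMr// -subr_ge0.
    have -> : `|x| ^+ 2 + `|y| ^+ 2 - `|x| * `|y| * 2 = (`|x| - `|y|) ^+ 2 by ring.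
    by rewrite real_exprn_even_ge0// rpredB ?normr_real.
  have : `|pairing z w| <=
      (\sum_j `|z 0 j| ^+ 2 + \sum_j `|w 0 j| ^+ 2) / 2.
    rewrite -big_split/= mulr_suml (le_trans (ler_norm_sum _ _ _))//.
    by apply: ler_sum => j _; exact: amgm.
  move/le_lt_trans; apply; rewrite ltr_pdivrMr// mul1r.
  by rewrite -[2]/(1 + 1) ltrD ?ball_ptP.
by rewrite -p1 normr1 ltxx.
Qed.

Lemma pairing0r z : pairing z 0b = 0.
Proof. by rewrite /pairing big1// => j _; rewrite mxE rmorph0 mulr0. Qed.

Lemma pairing0l z : pairing 0b z = 0.
Proof. by rewrite /pairing big1// => j _; rewrite mxE mul0r. Qed.

Section ReproducingKernel.
Variables (k : B -> B -> bop H H) (K : rkhs k).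

Lemma ip_kerop w h (f : K) : ip (kerop K w h) f = ip h (ev K w f).
Proof. exact: adj_ip. Qed.

Lemma ev_kerop z w h : ev K z (kerop K w h) = k z w h.
Proof. by rewrite -(ev_kernel K) bcompE. Qed.

(** The kernels k_w h are total, because an element orthogonal to all of them
    vanishes at every point. *)
Lemma kerop_ext (V : hilbertType R) (S T : bop K V) :
  (forall w h, S (kerop K w h) = T (kerop K w h)) -> S = T.
Proof.
move=> ST; rewrite -(adjK S) -(adjK T); congr adj.
apply: bop_ext => y; apply: ev_inj => w; apply: ip_eqr => h.
by rewrite -!ip_kerop -!adjP ST.
Qed.

Lemma wkeropE w h j : wkerop K w h j = (w 0 j)^* *: kerop K w h.
Proof. by rewrite dsum_colE bop_scaleE. Qed.

Lemma ip_wkerop z w h g :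
  ip (wkerop K z h) (wkerop K w g) = pairing z w * ip h (k z w g).
Proof.
rewrite dsum_ipE /pairing mulr_suml; apply: eq_bigr => j _.
by rewrite !wkeropE ipZl ipZr conjCK ip_kerop ev_kerop mulrA.
Qed.

End ReproducingKernel.

Lemma dsum_map_wkerop k l (K : rkhs k) (L : rkhs l) (T : bop K L) (S : bop H H) w h :
  T (kerop K w h) = kerop L w (S h) ->
  dsum_map d T (wkerop K w h) = wkerop L w (S h).
Proof.
by move=> Tk; apply/ffunP => j; rewrite dsum_mapE !wkeropE bopZ Tk.
Qed.

(** * From the de Branges-Rovnyak space to the Herglotz space *)

Section Schur.
Variable c : B -> bop H H.
Hypothesis c_inv : forall z, invertible (I - c z).
Local Notation g z := (binv (I - c z)).

(** The Cayley transform of c in terms of the resolvent alone; this makes the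
    Herglotz kernel affine in g(z) and g(w)^*, so that differences of kernels
    telescope. *)
Lemma herglotz_funE z : herglotz_fun c z = 2 *: g z - I.
Proof.
apply: bop_ext => x; rewrite bcompE [RHS]bop_addE bop_oppE bop_scaleE !bidE.
have -> : (I + c z) x = 2 *: x - (I - c z) x.
  rewrite !bop_addE bop_oppE bidE opprD opprK addrA.
  by rewrite scaler_nat mulr2n addrK.
by rewrite bopB bopZ binvK.
Qed.

Lemma herglotz_kernelE z w :
  herglotz_kernel c z w = (1 - pairing z w)^-1 *: (g z + (g w)^† - I).
Proof.
rewrite /herglotz_kernel !herglotz_funE adj_sub adj_scale adj_id.
apply: bop_ext => x; rewrite !(bop_scaleE, bop_addE, bop_oppE) !bidE.
have -> : (2 : C)^* = 2 by rewrite rmorph_nat.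
rewrite addrACA -opprD -scalerDr -[x + x]/(x *+ 2) -(scaler_nat 2 x) -scalerBr scalerA.
by congr (_ *: _); rewrite mulrAC div1r mulVf ?mul1r// pnatr_eq0.
Qed.

Lemma herglotz_dbr_kernel z w :
  herglotz_kernel c z w = g z ∘ dbr_kernel c z w ∘ (g w)^†.
Proof.
rewrite herglotz_kernelE; apply: bop_ext => x.
rewrite !bcompE !bop_scaleE !bopZ; congr (_ *: _).
rewrite !(bop_addE, bop_oppE) bcompE !bidE bopB.
have gc y : g z (c z y) = g z y - y.
  rewrite -[X in _ = _ - X](binvK (c_inv z) y) -bopB; congr (g z _).
  by rewrite bop_addE bop_oppE bidE subKr.
have cg : (c w)^† ((g w)^† x) = (g w)^† x - x.
  have E : (I - c w)^† ((g w)^† x) = x.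
    by rewrite -bcompE -adj_comp (binvP (c_inv w)).1 adj_id bidE.
  by rewrite -[X in _ = _ - X]E adj_sub adj_id bop_addE bop_oppE bidE subKr.
by rewrite cg gc !bopB -[X in _ = _ - X]addrA -opprD subKr addrA.
Qed.

(** The kernel of K is tied to that of K(c) by an equation: the same space K(b)
    is used for c = b and for c = bA^*, where the two kernels agree without
    being convertible. *)
Section Transform.
Variables (k : B -> B -> bop H H) (K : rkhs k).
Hypothesis kE : k = dbr_kernel c.
Variables (L : rkhs (herglotz_kernel c)).
Variables (U : bop K L) (V : bop (dsum d L) L).
Hypothesis UP : is_dbr_to_herglotz c U.
Hypothesis VP : is_herglotz_isometry V.

(** U multiplies by g, so its adjoint acts on kernels by g(w)^*. *)
Lemma transform_adj_kerop w h : U^† (kerop L w h) = kerop K w ((g w)^† h).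
Proof.
by apply: ip_eq => f; rewrite adj_ip !ip_kerop UP adj_ip.
Qed.

(** Unitarity of U in the form used below: the kernel identity shows that U maps
    k_w to K_w (I - c(w))^*, and not merely U^* K_w to k_w g(w)^*. *)
Lemma transform_kerop w h : U (kerop K w h) = kerop L w ((I - c w)^† h).
Proof.
apply: ev_inj => z; rewrite UP !ev_kerop herglotz_dbr_kernel -kE !bcompE.
by rewrite -[(g w)^† _]bcompE -adj_comp (binvP (c_inv w)).2 adj_id bidE.
Qed.

(** The identity that makes V isometric on the span of the w^* K_w h: with
    p = zw^*, (1 - p) K(z,w) = K(z,0) + K(0,w) - K(0,0), so the second difference
    of K at the origin is p K(z,w). *)
Lemma herglotz_isometry_ip z w h h' :
  ip (kerop L z h - kerop L 0b h) (kerop L w h' - kerop L 0b h') =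
  ip (wkerop L z h) (wkerop L w h').
Proof.
rewrite ip_wkerop ipBl !ip_kerop !bopB !ev_kerop -ipBr !herglotz_kernelE.
rewrite !pairing0r !pairing0l subr0 invr1 !scale1r bop_scaleE.
have pE : pairing z w * (1 - pairing z w)^-1 = (1 - pairing z w)^-1 - 1.
  have := pairing_neq1 z w; move: (pairing z w) => p p1.
  by field.
rewrite -ipZr scalerA pE scalerBl scale1r !(bop_addE, bop_oppE) !bidE.
congr (ip h _); rewrite -addrA -opprD; congr (_ - _).
have E (a e a0 e0 i : H) :
    a + e0 - i + (a0 + e - i - (a0 + e0 - i)) = a + e - i.
  have -> : a0 + e - i - (a0 + e0 - i) = e - e0.
    by rewrite opprB addrA subrK opprD addrACA subrr add0r.
  by rewrite [a + e0 - i]addrAC -(addrA (a - i)) (addrC e0) subrK addrAC.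
exact: E.
Qed.

(** V^* V m = m for m in the initial space, without the orthogonal projection onto
    it: n = V^* V m - m is orthogonal to the vectors w^* K_w h since V preserves
    their inner products, so V n = 0, and then < n, n > = < V n, V m > - < n, m > = 0. *)
Lemma herglotz_isometry_adj w h : V^† (kerop L w h - kerop L 0b h) = wkerop L w h.
Proof.
rewrite -VP.2; set m := wkerop L w h.
apply/subr0_eq/ip_def; set n := _ - m.
have mn z h' : ip (wkerop L z h') n = 0.
  by rewrite ipBr -adjP !VP.2 herglotz_isometry_ip subrr.
have Vn : V n = 0.
  apply: VP.1.2; apply: ortho_closed_span => _ [z [h' ->]]; exact: mn.
by rewrite {2}/n ipBr -adjP Vn ip0l sub0r ip_conj mn rmorph0 oppr0.
Qed.

Local Notation W := (dsum_map d U^† ∘ V^†).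

(** V^* is known on the differences K_w - K_0 only, so W K_0 remains as an unknown
    constant; U^* contributes the factor g(w)^*. *)
Lemma pullback_kerop w h :
  W (kerop L w h) = wkerop K w ((g w)^† h) + W (kerop L 0b h).
Proof.
rewrite -{1}(subrK (kerop L 0b h) (kerop L w h)) bopD; congr (_ + _).
by rewrite bcompE herglotz_isometry_adj (dsum_map_wkerop (transform_adj_kerop w h)).
Qed.

(** W x is a Gleason-type quotient: pairing with w^* k_w recovers the increment
    x(w) - x(0). *)
Lemma ip_wkerop_pullback w h (x : L) :
  ip (wkerop K w h) (W x) = ip h ((I - c w) (ev L w x - ev L 0b x)).
Proof.
rewrite bcompE -adj_dsum_map -!adjP (dsum_map_wkerop (transform_kerop w h)).
by rewrite VP.2 ipBl !ip_kerop -ipBr adj_ip.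
Qed.

(** Here x = K_0 (I - c(0)) u, that is, W x is the minimal Gleason solution for c
    applied to u.  The increment of K_0 is g(w) - g(0), and
    (I - c(w)) (g(w) - g(0)) (I - c(0)) = c(w) - c(0). *)
Lemma ip_wkerop_gleason w h u :
  ip (wkerop K w h) (W (kerop L 0b ((I - c 0b) u))) = ip h (c w u - c 0b u).
Proof.
rewrite ip_wkerop_pullback !ev_kerop !herglotz_kernelE !pairing0r subr0 invr1.
rewrite !scale1r; congr (ip h _); set v := (I - c 0b) u.
have -> : (g w + (g 0b)^† - I) v - (g 0b + (g 0b)^† - I) v = g w v - g 0b v.
  rewrite !(bop_addE, bop_oppE).
  by rewrite opprB addrA subrK opprD addrACA subrr addr0.
rewrite bopB binvKr// binvK// /v !(bop_addE, bop_oppE) !bidE.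
by rewrite opprB addrC addrA subrK.
Qed.

(** Minimality: the range of W lies in the closed span of the w^* k_w h.  U maps a
    vector orthogonal to this span to one orthogonal to the initial space of V. *)
Lemma ip_pullback_eq0 (x : dsum d K) :
  (forall w h, ip (wkerop K w h) x = 0) -> forall u, ip x (W u) = 0.
Proof.
move=> x0 u; rewrite bcompE -adj_dsum_map -!adjP.
rewrite (_ : V _ = 0) ?ip0l//; apply: VP.1.2.
apply: ortho_closed_span => _ [w [h ->]].
rewrite -adj_ip adj_dsum_map (dsum_map_wkerop (transform_adj_kerop w h)).
exact: x0.
Qed.

End Transform.
End Schur.

(** Two Herglotz spaces over the same K have pullbacks with values in the same
    subspace, on which vectors are separated by the w^* k_w h. *)
Lemma pullback_eq (c c' : B -> bop H H) k (K : rkhs k)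
    (L : rkhs (herglotz_kernel c)) (L' : rkhs (herglotz_kernel c'))
    (U : bop K L) (U' : bop K L') (V : bop (dsum d L) L) (V' : bop (dsum d L') L')
    (u : L) (u' : L') :
  is_dbr_to_herglotz c U -> is_dbr_to_herglotz c' U' ->
  is_herglotz_isometry V -> is_herglotz_isometry V' ->
  (forall w h, ip (wkerop K w h) ((dsum_map d U^† ∘ V^†) u) =
               ip (wkerop K w h) ((dsum_map d U'^† ∘ V'^†) u')) ->
  (dsum_map d U^† ∘ V^†) u = (dsum_map d U'^† ∘ V'^†) u'.
Proof.
move=> UP UP' VP VP' E; apply/subr0_eq/ip_def; set x := _ - _.
have x0 w h : ip (wkerop K w h) x = 0 by rewrite ipBr E subrr.
by rewrite {2}/x ipBr (ip_pullback_eq0 UP VP x0) (ip_pullback_eq0 UP' VP' x0) subrr.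
Qed.

(** * The weighted Cauchy transform *)

Section Cauchy.
Variables (F : fock R d) (c : B -> bop H H) (mu : bop F F -> bop H H).
Variables (P : P2space mu) (k : B -> B -> bop H H) (K : rkhs k) (T : bop P K).
Hypothesis c_inv : forall z, invertible (I - c z).
Hypothesis kE : k = dbr_kernel c.
Hypothesis muP : is_herglotz_map c mu.
Hypothesis TP : is_weighted_cauchy c T.

Lemma adj_szego w : (binv (bid F - Lzs F w))^† = binv (bid F - zLs F w).
Proof.
rewrite adj_binv adj_sub adj_id /Lzs /zLs adj_sum.
by under eq_bigr do rewrite adj_scale conjCK.
Qed.

Lemma free_szego_gen w : free_szego (binv (bid F - Lzs F w)).
Proof.
apply: subset_closure; exists 1%N, (fun=> 1), (fun=> binv (bid F - Lzs F w)).
by split=> [_|]; [exists w|rewrite big_ord1 scale1r].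
Qed.

(** Pairing F^* k_w h with p (x) u evaluates the Cauchy transform of p (x) u at w;
    its weight I - c(w) moves onto h, and its resolvent in wL^* becomes, by
    [adj_szego], the free Szego kernel at w. *)
Lemma cauchy_adj_kerop w h : T^† (kerop K w h) =
  tensor P (binv (bid F - Lzs F w)) ((I - c w)^† h).
Proof.
apply: (total_ip_eq (tensor_total P)) => _ [p [u [pS ->]]].
rewrite -adjP [LHS]ip_conj ip_kerop TP// [RHS]ip_conj; congr (_^*).
by rewrite tensor_ip//; [rewrite adj_szego adj_ip|exact: free_szego_gen].
Qed.

(** The Gram matrix of the vectors F^* k_w h is (I - c(z)) K^c(z,w) (I - c(w))^*,
    the kernel of K. *)
Lemma cauchy_coisometry : T ∘ T^† = bid K.
Proof.
apply: kerop_ext => w h; rewrite bcompE bidE cauchy_adj_kerop.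
apply: ev_inj => z; rewrite TP; last exact: free_szego_gen.
rewrite muP.2 herglotz_dbr_kernel// !bcompE binvKr//.
by rewrite -[_^† (_^† _)]bcompE -adj_comp (binvP (c_inv w)).2 adj_id bidE ev_kerop kE.
Qed.

End Cauchy.
End Kernels.

(** * The adjoint of the compressed shift *)

Theorem theorem4p16 (R : realType) (d : nat) (H : hilbertType R)
    (b : unit_ball R d -> bop H H) (A : bop H H)
    (H2 : rkhs (@drury_arveson R d H))
    (K : rkhs (dbr_kernel b))
    (Lb : rkhs (herglotz_kernel b))
    (LA : rkhs (herglotz_kernel (fun z => b z ∘ A^†)))
    (Vb : bop (dsum d Lb) Lb) (VA : bop (dsum d LA) LA)
    (Ub : bop K Lb) (UA : bop K LA)
    (Fock : fock R d) (mu : bop Fock Fock -> bop H H)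
    (P2 : P2space mu) (FA : bop P2 K)
    (X : bop (dsum d K) K) :
  (0 < d)%N ->
  (exists h : H, h != 0) ->
  (exists D : set H, countable D /\ dense D) ->
  schur_class H2 b ->
  purely_contractive b ->
  unitary A ->
  is_herglotz_isometry Vb ->
  is_herglotz_isometry VA ->
  is_dbr_to_herglotz b Ub ->
  is_dbr_to_herglotz (fun z => b z ∘ A^†) UA ->
  is_herglotz_map (fun z => b z ∘ A^†) mu ->
  is_weighted_cauchy (fun z => b z ∘ A^†) FA ->
  let VhatA := compressed_shift VA UA FA in
  let B := gleason_min Vb Ub in
  is_gleason_min_space B X ->
  dsum_map d FA ∘ VhatA^† =
  (X^† + B ∘ A^† ∘ binv (bid H - b (origin R d) ∘ A^†)
           ∘ (kerop K (origin R d))^†) ∘ FA.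
Proof.
move=> _ _ _ _ bc uA VbP VAP UbP UAP muP FAP VhatA B XP.
set c := fun z => b z ∘ A^†.
have bi z : invertible (bid H - b z).
  by apply: id_sub_contraction_invertible; exact: bc.
have ci z : invertible (bid H - c z).
  apply: id_sub_contraction_invertible.
  exact: le_lt_trans (opnorm_comp_unitary (b z) uA) (bc z).
have kE : dbr_kernel b = dbr_kernel c by rewrite -(dbr_kernel_unitary b uA).
have FF : FA ∘ FA^† = bid K := cauchy_coisometry ci kE muP FAP.
have -> : dsum_map d FA ∘ VhatA^† = dsum_map d UA^† ∘ VA^† ∘ UA ∘ FA.
  (* The Cauchy transforms cancel: F (U F)^* = U^*. *)
  have FC : FA ∘ (UA ∘ FA)^† = UA^†.
    rewrite adj_comp bcompA FF.
    by apply: bop_ext => x; rewrite bcompE bidE.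
  rewrite /VhatA /compressed_shift (adj_comp (_ ∘ VA)) (adj_comp _ VA) adjK.
  by rewrite adj_dsum_map bcompA -dsum_map_comp FC !bcompA.
congr (_ ∘ FA); apply: kerop_ext => w h; rewrite bop_addE.
have BE v : B v = (dsum_map d Ub^† ∘ Vb^†)
    (kerop Lb (origin R d) ((bid H - b (origin R d)) v)).
  by rewrite /B /gleason_min bcompE [LHS]bcompE.
set g0 := binv _.
(* The minimal Gleason solution for bA^* is BA^*. *)
have key u : (dsum_map d UA^† ∘ VA^†) (kerop LA (origin R d) u) = B (A^† (g0 u)).
  rewrite BE -{1}(binvKr (ci (origin R d)) u).
  apply: (pullback_eq UAP UbP VAP VbP) => w' h'.
  rewrite (ip_wkerop_gleason ci kE UAP VAP) (ip_wkerop_gleason bi erefl UbP VbP).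
  by rewrite /c !bcompE.
move: B XP BE key => B XP _ key.
rewrite bcompE (transform_kerop ci kE UAP) (pullback_kerop ci UAP VAP) key.
have -> : (binv (bid H - c w))^† ((bid H - c w)^† h) = h.
  by rewrite -bcompE -adj_comp (binvP (ci w)).2 adj_id bidE.
have /(congr1 (fun T : bop H _ => T h)) := XP w.
rewrite bcompE bop_addE bop_oppE bcompE => ->.
rewrite -addrA; congr (_ + _); rewrite !bcompE adjK ev_kerop.
rewrite bop_scaleE pairing0l subr0 invr1 scale1r.
rewrite adj_sub adj_id adj_comp adjK !(bop_addE, bop_oppE) !bcompE !bidE.
set y := (b w)^† h.
(* A^* g(0) (A - b(0)) = I, since b(0) = c(0) A. *)
have yE : y = A^† (g0 (A y - b (origin R d) y)).
  have -> : A y - b (origin R d) y = (bid H - c (origin R d)) (A y).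
    by rewrite bop_addE bop_oppE bidE bcompE -[A^† _]bcompE uA.1 bidE.
  by rewrite (binvK (ci _)) -bcompE uA.1 bidE.
rewrite {2}yE -(bopN B) -(bopN A^†) -(bopN g0).
rewrite -(bopD B) -(bopD A^†) -(bopD g0).
by rewrite opprB [in RHS]addrC addrA subrK.
Qed.
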